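(* Let $G$ be a Hausdorff FSIN topological group satisfying at least one of the following conditions: (i) $G$ is a topological subgroup of a product of (an arbitrary family of) second-countable Hausdorff topological groups; (ii) $G$ is separable; (iii) $G$ is Lindelöf; (iv) $G$ is $\sigma$-compact; (v) $G$ is countable. Then $G$ is SIN.
   Context: Let $G$ be a topological group with identity $e$ and neighbourhood filter $\mathcal N_G(e)$ of $e$. The left (respectively right) uniformity of $G$ is generated by the entourages $\{(x,y)\in G\times G: x^{-1}y\in V\}$ (respectively $\{(x,y)\in G\times G: xy^{-1}\in V\}$), where $V$ ranges over $\mathcal N_G(e)$. $G$ is SIN (balanced) if its left and right uniformities coincide; equivalently, every identity neighbourhood contains an identity neighbourhood invariant under all inner automorphisms. A function $f:G\to\mathbb R$ is left (right) uniformly continuous if it is uniformly continuous with respect to the left (right) uniformity. $G$ is FSIN (functionally balanced) if every bounded left uniformly continuous function $f:G\to\mathbb R$ is right uniformly continuous. A topological subgroup carries the subspace topology, and products carry the product topology. *)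

(* Defs.v *)
From HB Require Import structures.
From mathcomp Require Import all_boot all_order all_algebra.
From mathcomp Require Import all_classical all_reals.
From mathcomp Require Import topology normedtype.
Set Implicit Arguments.
Unset Strict Implicit.
Unset Printing Implicit Defensive.
Import numFieldNormedType.Exports.
Local Open Scope classical_set_scope.
Local Open Scope group_scope.

HB.mixin Record isTopologicalGroup G & Topological G & Group G := {
  mulg_continuous : continuous (fun x : G * G => x.1 * x.2) ;
  invg_continuous : continuous (fun x : G => x^-1) ;
}.

#[short(type="topologicalGroupType")]
HB.structure Definition TopologicalGroup :=
  {G of Topological G & Group G & isTopologicalGroup G}.

Section GroupUniformities.
Variable G : topologicalGroupType.
Implicit Types (V : set G) (x y : G).

Definition left_ent : set_system (G * G) :=
  filter_from (nbhs (1 : G)) (fun V => [set xy | V (xy.1^-1 * xy.2)]).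

Definition right_ent : set_system (G * G) :=
  filter_from (nbhs (1 : G)) (fun V => [set xy | V (xy.1 * xy.2^-1)]).

Lemma mulgl_continuous x : continuous (fun y : G => x * y).
Proof.
move=> y; apply: (@continuous_comp _ _ _ (fun y => (x, y))
  (fun z : G * G => z.1 * z.2)); last exact: mulg_continuous.
by apply: cvg_pair; [exact: cvg_cst|exact: cvg_id].
Qed.

Lemma mulgr_continuous x : continuous (fun y : G => y * x).
Proof.
move=> y; apply: (@continuous_comp _ _ _ (fun y => (y, x))
  (fun z : G * G => z.1 * z.2)); last exact: mulg_continuous.
by apply: cvg_pair; [exact: cvg_id|exact: cvg_cst].
Qed.

Lemma nbhs1_split V : nbhs (1 : G) V ->
  exists2 W, nbhs (1 : G) W & forall x y, W x -> W y -> V (x * y).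
Proof.
move=> V1; have := @mulg_continuous G (1, 1) V.
rewrite /= mulg1 => /(_ V1) [[A B] /= [A1 B1] AB].
exists (A `&` B); first exact: filterI.
by move=> x y [Ax _] [_ By]; exact: (AB (x, y)).
Qed.

Lemma nbhs1_inv V : nbhs (1 : G) V -> nbhs (1 : G) [set x | V x^-1].
Proof. by move=> V1; apply: (@invg_continuous G); rewrite invg1. Qed.

Lemma left_ent_filter : Filter left_ent.
Proof.
apply: filter_from_filter; first by exists setT; exact: filterT.
by move=> A B A1 B1; exists (A `&` B); first exact: filterI.
Qed.

Lemma right_ent_filter : Filter right_ent.
Proof.
apply: filter_from_filter; first by exists setT; exact: filterT.
by move=> A B A1 B1; exists (A `&` B); first exact: filterI.
Qed.

Lemma left_ent_diagonal A : left_ent A -> diagonal%relation `<=` A.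
Proof.
move=> [V V1 VA] [x y] xy; apply: VA => /=.
have <- : x = y := xy.
by rewrite mulVg; exact: nbhs_singleton.
Qed.

Lemma right_ent_diagonal A : right_ent A -> diagonal%relation `<=` A.
Proof.
move=> [V V1 VA] [x y] xy; apply: VA => /=.
have <- : x = y := xy.
by rewrite mulgV; exact: nbhs_singleton.
Qed.

Lemma left_ent_inv A : left_ent A -> left_ent A^-1%relation.
Proof.
move=> [V /nbhs1_inv V1 VA]; exists [set x | V x^-1] => //= -[x y] /=.
by rewrite invgM invgK => ?; exact: VA.
Qed.

Lemma right_ent_inv A : right_ent A -> right_ent A^-1%relation.
Proof.
move=> [V /nbhs1_inv V1 VA]; exists [set x | V x^-1] => //= -[x y] /=.
by rewrite invgM invgK => ?; exact: VA.
Qed.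

Lemma left_ent_split A : left_ent A ->
  exists2 B, left_ent B & (B \; B)%relation `<=` A.
Proof.
move=> [V /nbhs1_split[W W1 WV] VA].
exists [set xy | W (xy.1^-1 * xy.2)]; first by exists W.
move=> [x y] [z /= Wxz Wzy]; apply: VA => /=.
by have := WV _ _ Wxz Wzy; rewrite -mulgA mulVKg.
Qed.

Lemma right_ent_split A : right_ent A ->
  exists2 B, right_ent B & (B \; B)%relation `<=` A.
Proof.
move=> [V /nbhs1_split[W W1 WV] VA].
exists [set xy | W (xy.1 * xy.2^-1)]; first by exists W.
move=> [x y] [z /= Wxz Wzy]; apply: VA => /=.
by have := WV _ _ Wxz Wzy; rewrite -mulgA mulKg.
Qed.

Lemma left_ent_nbhsE : nbhs = nbhs_ left_ent.
Proof.
apply/funext => x; apply/seteqP; split => [A Ax|A [E [V V1 VE] EA]].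
  exists [set xy | A (x * (xy.1^-1 * xy.2))]; last first.
    by move=> y /xsectionP /=; rewrite mulVKg.
  exists [set z | A (x * z)] => //.
  by apply: (@mulgl_continuous x); rewrite mulg1.
have: nbhs x [set y | V (x^-1 * y)].
  by apply: (@mulgl_continuous x^-1); rewrite mulVg.
by apply: filterS => y Vy; apply/EA/xsectionP/VE.
Qed.

Lemma right_ent_nbhsE : nbhs = nbhs_ right_ent.
Proof.
apply/funext => x; apply/seteqP; split => [A Ax|A [E [V V1 VE] EA]].
  exists [set xy | A ((xy.1 * xy.2^-1)^-1 * x)]; last first.
    by move=> y /xsectionP /=; rewrite invgM invgK mulgVK.
  exists [set z | A (z^-1 * x)] => //.
  have: nbhs (1 : G) [set z | A (z * x)].
    by apply: (@mulgr_continuous x); rewrite mul1g.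
  by move/nbhs1_inv.
have /nbhs1_inv V1' := V1.
have: nbhs x ((fun y => y * x^-1) @^-1` [set z | V z^-1]).
  by apply: (@mulgr_continuous x^-1); rewrite mulgV.
by apply: filterS => y /=; rewrite invgM invgK => Vy; apply/EA/xsectionP/VE.
Qed.

End GroupUniformities.

(* Aliases of the carrier of G, needed because a type has at most one canonical
   uniform structure; both keep the topology of G. *)
Definition left_uniform (G : Type) : Type := G.
Definition right_uniform (G : Type) : Type := G.

HB.instance Definition _ (G : topologicalGroupType) :=
  Topological.copy (left_uniform G) G.
HB.instance Definition _ (G : topologicalGroupType) :=
  Nbhs_isUniform_mixin.Build (left_uniform G) (@left_ent_filter G)
    (@left_ent_diagonal G) (@left_ent_inv G) (@left_ent_split G)
    (left_ent_nbhsE G).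

HB.instance Definition _ (G : topologicalGroupType) :=
  Topological.copy (right_uniform G) G.
HB.instance Definition _ (G : topologicalGroupType) :=
  Nbhs_isUniform_mixin.Build (right_uniform G) (@right_ent_filter G)
    (@right_ent_diagonal G) (@right_ent_inv G) (@right_ent_split G)
    (right_ent_nbhsE G).

Section ProductGroup.
Variables (I : Type) (H : I -> topologicalGroupType).
Local Notation P := (prod_topology H).
Implicit Types f g : P.

Definition prodg_one : P := fun=> 1.
Definition prodg_mul f g : P := fun i => f i * g i.
Definition prodg_inv f : P := fun i => (f i)^-1.

Fact prodg_mulA : associative prodg_mul.
Proof.
by move=> f g h; apply/functional_extensionality_dep => i; exact: mulgA.
Qed.

Fact prodg_mul1 : left_id prodg_one prodg_mul.
Proof. by move=> f; apply/functional_extensionality_dep => i; exact: mul1g. Qed.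

Fact prodg_mulr1 : right_id prodg_one prodg_mul.
Proof. by move=> f; apply/functional_extensionality_dep => i; exact: mulg1. Qed.

Fact prodg_mulV : left_inverse prodg_one prodg_inv prodg_mul.
Proof. by move=> f; apply/functional_extensionality_dep => i; exact: mulVg. Qed.

Fact prodg_mulrV : right_inverse prodg_one prodg_inv prodg_mul.
Proof. by move=> f; apply/functional_extensionality_dep => i; exact: mulgV. Qed.

HB.instance Definition _ := isGroup.Build P
  prodg_mulA prodg_mul1 prodg_mulr1 prodg_mulV prodg_mulrV.

Lemma prodg_eval_continuous i : continuous (fun f : P => f i).
Proof.
move=> f A; rewrite nbhsE => -[B [oB Bfi] BA].
have /cvg_sup/(_ i) : nbhs f --> f by exact: cvg_id.
apply; exists ((fun g : P => g i) @^-1` B).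
by split=> //; [exists B|move=> g /= /BA].
Qed.

Lemma prodg_cvg (F : set_system P) f : Filter F ->
  (forall i, (fun g : P => g i) @ F --> f i) -> F --> f.
Proof.
move=> FF Ff; apply/cvg_sup => i A [_ [[B oB <-] Bf BA]].
by apply: filterS BA _; apply: (Ff i); exact: open_nbhs_nbhs.
Qed.

Fact prodg_mul_continuous : continuous (fun x : P * P => (x.1 * x.2 : P)).
Proof.
move=> fg; apply: prodg_cvg => i.
suff : continuous (fun x : P * P => x.1 i * x.2 i) by apply.
move=> {}fg; apply: (@continuous_comp (P * P)%type (H i * H i)%type (H i)
  (fun x => (x.1 i, x.2 i)) (fun z => z.1 * z.2)); last exact: mulg_continuous.
apply: cvg_pair.
- by apply: (@continuous_comp (P * P)%type P _ fst (fun h : P => h i));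
    [exact: cvg_fst|exact: prodg_eval_continuous].
- by apply: (@continuous_comp (P * P)%type P _ snd (fun h : P => h i));
    [exact: cvg_snd|exact: prodg_eval_continuous].
Qed.

Fact prodg_inv_continuous : continuous (fun f : P => (f^-1 : P)).
Proof.
move=> f; have FF : Filter ((fun h : P => (h^-1 : P)) @ f).
  exact: (@fmap_filter P P _ (nbhs f) (nbhs_filter f)).
apply: prodg_cvg => i.
suff : continuous (fun h : P => (h i)^-1) by apply.
move=> {FF}f.
apply: (@continuous_comp P (H i) (H i) (fun h : P => h i) (fun z => z^-1)).
  exact: prodg_eval_continuous.
exact: invg_continuous.
Qed.

HB.instance Definition _ :=
  isTopologicalGroup.Build P prodg_mul_continuous prodg_inv_continuous.

End ProductGroup.

Definition SIN (G : topologicalGroupType) : Prop :=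
  @entourage (left_uniform G) = @entourage (right_uniform G).

Definition FSIN (R : realType) (G : topologicalGroupType) : Prop :=
  forall f : G -> R, [bounded f x | x in [set: G]] ->
    unif_continuous (f : left_uniform G -> R) ->
    unif_continuous (f : right_uniform G -> R).

(* G is isomorphic, as a topological group, to a subgroup of H with the
   subspace topology. *)
Definition topological_subgroup_of (G H : topologicalGroupType) : Prop :=
  exists phi : G -> H, [/\ injective phi, {morph phi : x y / x * y} &
    open = [set phi @^-1` V | V in open]].

Definition separable (T : topologicalType) : Prop :=
  exists2 S : set T, countable S & dense S.

Definition lindelof (T : topologicalType) : Prop :=
  forall C : set (set T), C `<=` open -> \bigcup_(U in C) U = [set: T] ->
    exists D : set (set T),
      [/\ D `<=` C, countable D & \bigcup_(U in D) U = [set: T]].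

Definition sigma_compact (T : topologicalType) : Prop :=
  exists2 K : nat -> set T, (forall n, compact (K n)) &
    \bigcup_n K n = [set: T].

(* Main.v *)
Require Import Defs.
From mathcomp Require Import all_boot all_order all_algebra.
From mathcomp Require Import all_classical all_reals.
From mathcomp Require Import interval_inference ereal topology normedtype.
From mathcomp Require Import finmap lra.
Set Implicit Arguments.
Unset Strict Implicit.
Unset Printing Implicit Defensive.
Import Order.TTheory GRing.Theory Num.Theory.
Import numFieldNormedType.Exports.
Local Open Scope classical_set_scope.

(** The proof reduces all five conditions to a single one: [G] is narrow, that
    is, it is covered by countably many translates of each identity
    neighbourhood.  Narrowness holds in separable, Lindelof and sigma-compact
    groups, and passes to products and subgroups.  It remains to see that a
    narrow FSIN group is SIN.

    FSIN is used only through a consequence about sets, called absorption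
    here: for all [A] and all identity neighbourhoods [U] there is an identity
    neighbourhood [V] with [V A <= A U].  It follows by applying FSIN to the
    truncated distance to [A] for a left uniformly continuous pseudometric that
    is fine enough for [U] ([FSIN_absorbing]).  Since [V] depends on [A], the problem is
    to find one [A] whose [V] has all its conjugates inside [U].

    If some identity neighbourhood is totally bounded, let [L] be one whose
    square is totally bounded, and let [A] be maximal such that the sets [L a P], [a] in [A], are
    pairwise disjoint, [P] being small.  Then [V A <= A P] with [V <= L] forces
    [v a] to lie in [a P], so [a^-1 V a <= P] for [a] in [A].  Taking [L] and [P]
    symmetric, maximality gives [G = L L A P P], and [L L <= D V] with [D] finite, so each [x] is
    [f a p] with [f] in [D], [a] in [A] and [p] small; shrinking [V] so that its
    conjugates by the finitely many [f] are controlled handles all [x]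
    ([inner_invariant_base_totally_bounded]).

    If no identity neighbourhood is totally bounded, take a maximal [S] whose
    translates [s K] are disjoint; by narrowness [S] is countable and carries an
    injective labelling [c] by natural numbers.  In a small neighbourhood choose
    an infinite uniformly separated sequence [w], and let [A] consist of the
    points [s (w i)] with [i <= c s].  The [c s + 1] points of [A] near [s] are
    moved by [v] to distinct points of [A] near a single [t], whence
    [c s <= c t].  The same for [v^-1] gives [c s = c t], hence [s = t], so
    [s^-1 v s] is in [K] for all [s] in [S], and [S K K = G] extends this to
    all conjugates ([inner_invariant_base_narrow]). *)

(** * Uniformly continuous functions separating a set from far points *)

Section SeparatingFunction.
Local Open Scope ring_scope.

(** [f] is the distance to [A], truncated at [e], for a pseudometric that
    defines a coarser uniformity in which [E] is still an entourage.  The radius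
    [e] is such that the entourage of pairs at distance less than [e] is
    included in [E]. *)
Lemma unif_continuous_separation (R : realType) (T : uniformType) (A : set T)
    (E : set (T * T)) (a0 : T) : A a0 -> entourage E ->
  exists (f : T -> R) (e : R),
  [/\ 0 < e, [bounded f x | x in [set: T]], unif_continuous f,
      (forall a, A a -> f a = 0) &
      forall x, f x < e -> exists2 a, A a & E (a, x)].
Proof.
move=> A0 entE; pose T' : pseudoMetricType R := gauge.type entE.
have [e eE] : exists e : {posnum R},
    forall x y : T', ball x e%:num y -> E (x, y).
  have : @entourage T' E by exists 0%N => // -[x y] [].
  rewrite -entourage_ballE => -[_/posnumP[e] eE].
  by exists e => x y xy; exact: (eE (x, y)).
pose d (x : T') := @edist_inf R T' A x.
have dfin x : d x \is a fin_num.
  rewrite ge0_fin_numE ?edist_inf_ge0//.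
  apply: (@le_lt_trans _ _ (edist (x, a0 : T'))).
    by apply: ereal_inf_lbound; exists a0.
  (* The pseudometric of a countable uniformity is bounded by construction,
     which makes the distance to a nonempty set finite. *)
  rewrite -ge0_fin_numE ?edist_ge0//; apply/edist_finP => /=; exists 2 => //.
  exact: countable_uniform.countable_uniform_bounded.
have lip (x y : T') r : 0 < r -> ball x r y -> fine (d x) <= r + fine (d y).
  move=> r0 xy; rewrite -lee_fin EFinD !fineK//.
  apply: (le_trans (@edist_inf_triangle R T' A x y)).
  by rewrite leeD2r// edist_fin.
exists (fun x => Num.min (fine (d x)) e%:num), e%:num; split => //.
- exists e%:num; split=> // M eM x _ /=.
  rewrite ger0_norm ?le_min ?fine_ge0 ?edist_inf_ge0//=.
  by rewrite ge_min (ltW eM) orbT.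
- move=> B; rewrite -entourage_ballE => -[r /= r0 rB].
  have : @entourage T' [set xy | ball xy.1 (r / 2) xy.2].
    by rewrite -entourage_ballE; exists (r / 2) => //=; exact: divr_gt0.
  move=> /(gauge.gauge_ent entE).
  apply: (@filterS _ (@entourage T)) => -[x y] /= xy; apply: rB.
  rewrite /ball /=.
  have r2 : 0 < r / 2 by exact: divr_gt0.
  have := lip x y _ r2 xy; have := lip y x _ r2 (ball_sym xy).
  have : r / 2 < r by rewrite ltr_pdivrMr// ltr_pMr// ltr1n.
  move: (fine (d x)) (fine (d y)) (r / 2) => u v t tr uv vu.
  apply: le_lt_trans tr; rewrite ler_norml lerBrDr lerBlDr.
  rewrite !minEle.
  by do 2 case: ifPn => //; rewrite -?ltNge; lra.
- by move=> a Aa; rewrite /d edist_inf0//= min_l.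
- move=> x; rewrite gt_min ltxx orbF -lte_fin fineK//.
  move=> /ereal_inf_lt[_ [a Aa <-]] xa.
  exists a => //; apply: eE; apply: ball_sym.
  exact: (@edist_lt_ball R T' _ (x, a)).
Qed.
End SeparatingFunction.

(** * Maximal disjoint families *)

(** An [F x] disjoint from all the chosen sets could be added to them; as it is
    nonempty, [x] is not among the chosen indices already. *)
Lemma maximal_disjoint_family (T U : Type) (F : T -> set U) (D : set T) :
  (forall x, F x !=set0) -> exists S,
  [/\ S `<=` D,
      forall s t z, S s -> S t -> F s z -> F t z -> s = t &
      forall x, D x -> exists2 s, S s & F x `&` F s !=set0].
Proof.
move=> F0; have [S [SD triS maxS]] := ex_maximal_disjoint_subcollection F D.
exists S; split=> // [s t z Ss St Fsz Ftz|x Dx].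
  by apply: triS => //; exists z.
apply: contrapT => nS.
have Sx : ~ S x by move=> Sx; apply: nS; exists x; rewrite ?setIid.
apply: (maxS (x |` S)).
- split; first by move=> y Sy; right.
  by move=> /(_ x (or_introl erefl)).
- by move=> y [->|/SD].
- move=> s t [->|Ss] [->|St] //.
  + by move=> xt; exfalso; apply: nS; exists t.
  + by rewrite setIC => xs; exfalso; apply: nS; exists s.
  + exact: triS.
Qed.

(** * Neighbourhoods of the identity *)

Section Neighbourhoods.
Local Open Scope group_scope.
Context (G : topologicalGroupType).
Implicit Types (x y : G) (U V W : set G).

Lemma nbhs1_root3 U : nbhs (1 : G) U -> exists W,
  [/\ nbhs (1 : G) W, forall x, W x -> W x^-1,
      forall x y, W x -> W y -> U (x * y) &
      forall x y z, W x -> W y -> W z -> U (x * y * z)].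
Proof.
move=> /nbhs1_split[U2 U21 U2U].
have [U4 U41 U42] := nbhs1_split U21; have U411 := nbhs_singleton U41.
have U4U2 x : U4 x -> U2 x by move=> ?; rewrite -[x]mulg1; exact: U42.
exists (U4 `&` [set x | U4 x^-1]); split.
- exact/filterI/nbhs1_inv.
- by move=> x [? ?]; split; rewrite /= ?invgK.
- by move=> x y [/U4U2 ? _] [/U4U2 ? _]; exact: U2U.
- by move=> x y z [? _] [? _] [/U4U2 ? _]; apply: U2U => //; exact: U42.
Qed.

Lemma nbhs1_conj V x : nbhs (1 : G) V -> nbhs (1 : G) [set v | V (x^-1 * v * x)].
Proof.
move=> V1; apply: (@mulgl_continuous _ x^-1 1 [set v | V (v * x)]).
by apply: (@mulgr_continuous _ x _ V); rewrite mulg1 mulVg.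
Qed.

(** This is SIN in terms of identity neighbourhoods. *)
Definition inner_invariant_base := forall U, nbhs (1 : G) U ->
  exists2 V, nbhs (1 : G) V & forall x v, V v -> U (x^-1 * v * x).

Lemma inner_invariant_base_SIN : inner_invariant_base -> SIN G.
Proof.
move=> inv; suff: @left_ent G = @right_ent G by [].
apply/seteqP; split=> E [U /inv[V V1 VU] UE]; exists [set x | V x^-1];
  [exact: nbhs1_inv| |exact: nbhs1_inv|] => -[x y] /= Vxy; apply: UE => /=.
- by have := VU x _ Vxy; rewrite invgM invgK mulgA mulgVK.
- by have := VU x^-1 _ Vxy; rewrite invgM !invgK mulgA mulgK.
Qed.

End Neighbourhoods.

(** * The set-theoretic content of FSIN *)

Section Absorption.
Local Open Scope group_scope.
Context (G : topologicalGroupType).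
Implicit Types (A U V : set G).

(** The conclusion is the inclusion [V A <= A U]; the neighbourhood [V] may
    depend on [A]. *)
Definition absorbing := forall A U, nbhs (1 : G) U ->
  exists2 V, nbhs (1 : G) V &
    forall v a, V v -> A a -> exists2 b, A b & U (b^-1 * v * a).

(** Let [f] be left uniformly continuous, zero on [A] and at least [e] outside
    [A U].  By FSIN, left translation by a small [v] changes [f] by less than
    [e], so it maps the points of [A] into [A U]. *)
Lemma FSIN_absorbing (R : realType) : FSIN R G -> absorbing.
Proof.
move=> fsin A U U1.
have [->|/set0P[a0 A0]] := eqVneq A set0.
  by exists setT => //; exact: filterT.
have entU : @entourage (left_uniform G) [set xy | U (xy.1^-1 * xy.2)].
  by exists U.
have [f [e [e0 /fsin fb /fb fu fA fU]]] :=
  @unif_continuous_separation R _ _ _ _ A0 entU.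
have : @entourage R [set xy | ball xy.1 e xy.2].
  by rewrite -entourage_ballE; exists e.
move=> /fu[V V1 Vf]; exists V => // v a Vv Aa.
have /(Vf (_, _)) : V (v * a * a^-1) by rewrite mulgK.
rewrite /ball /= (fA a)// subr0 => fva.
have /fU[b Ab Ub] : (f (v * a)%g < e)%R by exact: le_lt_trans (ler_norm _) fva.
by exists b => //; rewrite -mulgA.
Qed.
End Absorption.

(** * Total boundedness and narrowness *)

Section Absorbing.
Local Open Scope group_scope.
Context (G : topologicalGroupType).
Implicit Types (B D K S U V W : set G) (x y z : G).

Definition translates_cover D V B :=
  forall x, B x -> exists2 s, D s & V (s^-1 * x).

Definition totally_bounded B :=
  forall V, nbhs (1 : G) V -> exists2 D, finite_set D & translates_cover D V B.

(** The fibres of the colouring [c] are countably many [V]-small sets covering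
    [G].  This amounts to asking for countably many translates of each identity
    neighbourhood to cover [G]; unlike the latter, the condition on a single [V]
    is visibly stable under intersection and preimage by a homomorphism. *)
Definition narrow := forall V, nbhs (1 : G) V ->
  exists c : G -> nat, forall x y, c x = c y -> V (x^-1 * y).

(** * Groups with a totally bounded identity neighbourhood *)

(** For [v] near [1], the point [v a] lies in the piece [L a P] of the disjoint
    family, hence in no [b P] with [b] another point of [A]; finitely many left
    translations carry the points near [A] to all of [G]. *)
Lemma inner_invariant_base_totally_bounded W0 : absorbing G ->
  nbhs (1 : G) W0 -> totally_bounded W0 -> inner_invariant_base G.
Proof.
move=> absG W01 W0tb U U1.
have [W [W1 WV _ WU]] := nbhs1_root3 U1.
have [P [P1 PV _ PW]] := nbhs1_root3 W1.
have [L [L1 LV LW0 _]] := nbhs1_root3 W01.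
have [P11 L11] := (nbhs_singleton P1, nbhs_singleton L1).
pose F a := [set y | exists l w, [/\ L l, P w & y = l * a * w]].
have [|A [_ triA maxA]] := @maximal_disjoint_family G G F setT.
  by move=> a; exists a, 1, 1; rewrite mul1g mulg1.
have [V V1 VA] := absG A P P1.
have VL1 : nbhs (1 : G) (V `&` L) by exact: filterI.
have fixA a v : A a -> (V `&` L) v -> P (a^-1 * v * a).
  move=> Aa [Vv Lv]; have [b Ab Pb] := VA v a Vv Aa.
  have ba : b = a; last by rewrite ba in Pb.
  apply: (triA b a (v * a)) => //.
  - by exists 1, (b^-1 * v * a); rewrite mul1g !mulgA mulgV mul1g.
  - by exists v, 1; rewrite mulg1.
have [D /finite_fsetP[X ->] Dcov] := W0tb _ VL1.
exists (\bigcap_(f in [set` X]) [set v | (V `&` L) (f^-1 * v * f)]).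
  by apply: filter_bigI => f _; exact: nbhs1_conj.
move=> x v Xv.
have [a Aa [_ [[l [w [Ll Pw ->]]] [l' [w' [Ll' Pw' lxw]]]]]] := maxA x I.
have [f Xf VLf] := Dcov (l^-1 * l') (LW0 _ _ (LV _ Ll) Ll').
have Pa := fixA _ _ Aa VLf; have Pv := fixA _ _ Aa (Xv _ Xf).
(* Writing [l^-1 * l' = f * u] gives [x = f * (u * a) * (w' * w^-1)], where
   [u * a] differs from [a] by the small element [a^-1 * u * a]. *)
pose p := a^-1 * (f^-1 * (l^-1 * l')) * a * (w' * w^-1).
have Wp : W p.
  by rewrite /p mulgA; apply: PW => //; exact: PV.
have -> : x = f * a * p.
  rewrite -[LHS](mulKg l) -[X in _ * X](mulgK w) lxw /p.
  by rewrite !mulgA !mulgK mulgV mul1g.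
have Wv := PW _ _ _ Pv P11 P11; rewrite !mulg1 in Wv.
have := WU _ _ _ (WV _ Wp) Wv Wp.
by rewrite !invgM !mulgA.
Qed.

(** * Narrow groups without totally bounded identity neighbourhood *)

(** A maximal family of disjoint translates [x M] with [x] in [W] is infinite:
    otherwise the finitely many [x M M^-1] would cover [W]. *)
Lemma separated_sequence W : ~ totally_bounded W ->
  exists M (w : nat -> G), [/\ nbhs (1 : G) M, forall i, W (w i) &
    forall i j, M ((w i)^-1 * w j) -> i = j].
Proof.
move=> /existsNP[V /not_implyP[V1 nV]].
have [M [M1 MV MVV _]] := nbhs1_root3 V1.
have M11 := nbhs_singleton M1.
pose F x := [set y | M (x^-1 * y)].
have [|S [SW triS maxS]] := @maximal_disjoint_family G G F W.
  by move=> x; exists x; rewrite /F/= mulVg.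
have infS : infinite_set S.
  move=> finS; apply: nV; exists S => // x /maxS[s Ss [z [Fxz Fsz]]].
  exists s => //; have := MVV _ _ Fsz (MV _ Fxz).
  by rewrite invgM invgK mulgA mulgK.
have /infiniteP/card_leP[f] := infS.
pose w (n : nat) : G := set_val (f (to_setT n)).
have wS n : S (w n) by exact: set_valP.
have w_inj : injective w.
  move=> i j /val_inj/(inj (mem_set I) (mem_set I)).
  by move=> /(congr1 set_val).
exists M, w; split=> // [i|i j Mij]; first exact/SW/wS.
apply/w_inj/(triS _ _ (w j)) => //.
by rewrite /F/= mulVg.
Qed.

(** The number of points of [A] near [s] encodes [c s], so a left translation
    that almost maps [A] into itself can move [s] only to a point [t] with
    [c s <= c t].  Total boundedness is excluded to have room for these points
    in an arbitrarily small neighbourhood. *)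
Lemma inner_invariant_base_narrow : absorbing G -> narrow ->
  (forall W, nbhs (1 : G) W -> ~ totally_bounded W) -> inner_invariant_base G.
Proof.
move=> absG narG ntb U U1.
have [P [P1 PV _ PU]] := nbhs1_root3 U1.
have [K [K1 KV KP _]] := nbhs1_root3 P1.
have [W [W1 WV _ WK]] := nbhs1_root3 K1.
have [M0 [w [M01 Ww wM0]]] := separated_sequence (ntb _ W1).
have [M [M1 MV MM0 _]] := nbhs1_root3 M01.
have K11 := nbhs_singleton K1.
pose F x := [set y | K (x^-1 * y)].
have [|S [_ triS maxS]] := @maximal_disjoint_family G G F setT.
  by move=> x; exists x; rewrite /F/= mulVg.
have sepS s t y : S s -> S t -> K (s^-1 * y) -> K (t^-1 * y) -> s = t.
  exact: triS.
(* A colouring with [K]-small fibres separates the points of [S]. *)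
have [c cK] := narG K K1.
have cS s t : S s -> S t -> c s = c t -> s = t.
  move=> Ss St /cK Kst; apply: (sepS s t t) => //.
  by rewrite mulVg.
pose A := [set x | exists s i, [/\ S s, (i <= c s)%N & x = s * w i]].
have [V V1 VA] := absG A (M `&` W) (filterI M1 W1).
have move_up v s : V v -> S s ->
    exists t, [/\ S t, K (t^-1 * v * s) & (c s <= c t)%N].
  move=> Vv Ss.
  have step i : (i <= c s)%N -> exists t j, [/\ S t, (j <= c t)%N,
      K (t^-1 * v * s) & M ((t * w j)^-1 * v * (s * w i))].
    move=> ics; have [|_ [t [j [St jct ->]]] [Mtj Wtj]] := VA v (s * w i) Vv.
      by exists s, i.
    exists t, j; split=> //.
    have := WK _ _ _ (Ww j) Wtj (WV _ (Ww i)).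
    by rewrite invgM !mulgA mulgV mul1g mulgK.
  have [t [j [St _ Kt _]]] := step 0%N (leq0n _).
  exists t; split=> //.
  (* The point [t] does not depend on [i], because the translates [s * K] are
     disjoint. *)
  have {}step (i : nat) : exists j : nat, (i <= c s)%N ->
      (j <= c t)%N /\ M ((t * w j)^-1 * v * (s * w i)).
    have [ics|_] := leqP i (c s); last by exists 0%N.
    have [t' [k [St' kct' Kt' Mk]]] := step i ics.
    have <- : t' = t by apply: (sepS t' t (v * s)); rewrite // mulgA.
    by exists k.
  have [g gP] := choice step.
  have g_inj i i' : (i <= c s)%N -> (i' <= c s)%N -> g i = g i' -> i = i'.
    move=> /gP[_ Mi] /gP[_ Mi'] gi; apply: wM0; rewrite gi in Mi.
    have := MM0 _ _ (MV _ Mi) Mi'.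
    by rewrite !invgM !invgK !mulgA !(mulgK, mulgVK).
  pose h (i : 'I_(c s).+1) : 'I_(c t).+1 := inord (g i).
  have : injective h.
    move=> i i' /(congr1 val); rewrite /= !inordK ?ltnS.
    - by move=> /g_inj gi; apply/val_inj/gi; rewrite -ltnS.
    - by have [] := gP i' (ltn_ord i').
    - by have [] := gP i (ltn_ord i).
  by move=> /leq_card; rewrite !card_ord ltnS.
exists (V `&` [set v | V v^-1]); first exact/filterI/nbhs1_inv.
have fixS v s : V v -> V v^-1 -> S s -> K (s^-1 * v * s).
  move=> Vv Vv' Ss.
  have [t [St Kt cst]] := move_up _ _ Vv Ss.
  have [s' [Ss' Ks' cts']] := move_up _ _ Vv' St.
  have ss' : s = s'.
    apply: (sepS s s' (v^-1 * t)) => //; last by rewrite mulgA.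
    by have := KV _ Kt; rewrite !invgM invgK mulgA.
  have st : s = t; last by rewrite -st in Kt.
  by apply: cS => //; apply/eqP; rewrite eqn_leq cst ss'.
move=> x v [Vv Vv'].
have [s Ss [z [Fxz Fsz]]] := maxS x I.
have Psx : P (s^-1 * x).
  by have := KP _ _ Fsz (KV _ Fxz); rewrite invgM invgK mulgA mulgK.
have KsubP y : K y -> P y by move=> Ky; rewrite -[y]mulg1; exact: KP.
have := PU _ _ _ (PV _ Psx) (KsubP _ (fixS v s Vv Vv' Ss)) Psx.
by rewrite invgM invgK !mulgA !(mulgK, mulgVK).
Qed.
End Absorbing.

(** * Sources of narrowness *)

Section Narrowness.
Local Open Scope group_scope.
Context (G : topologicalGroupType).
Implicit Types (V K : set G).

Lemma countable_translates_narrow :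
  (forall V, nbhs (1 : G) V ->
    exists2 D, countable D & translates_cover D V [set: G]) ->
  narrow G.
Proof.
move=> cov V /nbhs1_root3[W [W1 WV WW _]].
have [D /countable_injP[c c_inj] Dcov] := cov W W1.
have /choice[d dP] x : exists s, D s /\ W (s^-1 * x).
  by have [s Ds Ws] := Dcov x I; exists s.
exists (c \o d) => x y /(c_inj _ _ (mem_set (dP x).1) (mem_set (dP y).1)) dxy.
have := WW _ _ (WV _ (dP x).2) (dP y).2.
by rewrite dxy invgM invgK mulgA mulgK.
Qed.

Lemma separable_narrow : separable G -> narrow G.
Proof.
move=> [D cD dD]; apply: countable_translates_narrow => V /nbhs1_inv V1.
exists D => // x _.
have : nbhs x [set y | V (x^-1 * y)^-1].
  by apply: (@mulgl_continuous _ x^-1 x [set z | V z^-1]); rewrite mulVg.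
rewrite nbhsE => -[O [oO Ox] OV].
have [||s [Os Ds]] := dD O => //; first by exists x.
by exists s => //; have := OV _ Os; rewrite /= invgM invgK.
Qed.

Lemma countable_narrow : countable [set: G] -> narrow G.
Proof.
by move=> cG; apply: separable_narrow; exists setT => // O O0 _; rewrite setIT.
Qed.

Lemma second_countable_narrow : @second_countable G -> narrow G.
Proof.
move=> [B cB [oB Bnbhs]]; apply: separable_narrow.
pose pt (O : set G) := xget 1 O.
exists (pt @` B); first exact: (card_le_trans (card_image_le _ _) cB).
move=> O [x Ox] oO.
have [|U [BU Ux] UO] := Bnbhs x O; first exact: open_nbhs_nbhs.
exists (pt U); split; last by exists U.
by apply: UO; apply: xgetPex; exists x.
Qed.

Lemma lindelof_narrow : lindelof G -> narrow G.
Proof.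
move=> lG; apply: countable_translates_narrow => V V1.
pose tr x := interior [set y | V (x^-1 * y)].
have trx x : tr x x.
  by apply: (@mulgl_continuous _ x^-1); rewrite mulVg.
have [||D [DC cD Dcov]] := lG (range tr).
- by move=> _ [x _ <-]; exact: open_interior.
- by apply/seteqP; split=> // x _; exists (tr x); [exists x|].
have /choice[ctr ctrP] U : exists x, D U -> tr x = U.
  have [DU|nDU] := pselect (D U); last by exists 1.
  by have [x _ xU] := DC U DU; exists x.
exists (ctr @` D); first exact: (card_le_trans (card_image_le _ _) cD).
move=> x _; have [U DU Ux] : (\bigcup_(U in D) U) x by rewrite Dcov.
exists (ctr U); first by exists U.
by rewrite -(ctrP U DU) in Ux; exact: (interior_subset Ux).
Qed.

(** A finite index set containing [x] covers the points near [x] by translates,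
    so the near covering property applies to the finite sets directed by
    inclusion. *)
Lemma compact_totally_bounded K : compact K -> totally_bounded K.
Proof.
move=> /compact_near_coveringP cK V V1.
pose F : set_system (set G) :=
  filter_from (@finite_set G) (fun D => [set E | D `<=` E]).
have FF : Filter F.
  apply: filter_from_filter; first by exists set0.
  move=> D E fD fE; exists (D `|` E); first by rewrite finite_setU.
  by move=> X DEX; split=> x Hx; apply: DEX; [left|right].
have [x Kx|D fD DK] := cK _ F (fun D x => exists2 s, D s & V (s^-1 * x)) FF.
  exists ([set y | V (x^-1 * y)], [set E | [set x] `<=` E]).
    split=> /=; first by apply: (@mulgl_continuous _ x^-1); rewrite mulVg.
    by exists [set x].
  by move=> [y E] /= [Vy /(_ x erefl) Ex]; exists x.
by exists D => // x Kx; exact: (DK D (@subset_refl _ _)).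
Qed.

Lemma sigma_compact_narrow : sigma_compact G -> narrow G.
Proof.
move=> [K cK KG]; apply: countable_translates_narrow => V V1.
have /choice[D DP] n : exists D, finite_set D /\ translates_cover D V (K n).
  by have [D] := compact_totally_bounded (cK n) V1; exists D.
exists (\bigcup_n D n).
  by apply: bigcup_countable => // n _; exact/finite_set_countable/(DP n).1.
move=> x _; have [n _ Kx] : (\bigcup_n K n) x by rewrite KG.
by have [s Ds Vs] := (DP n).2 x Kx; exists s => //; exists n.
Qed.
End Narrowness.

(** * Products and subgroups *)

Section NarrowSubgroup.
Local Open Scope group_scope.

(** [G] is narrow when this filter is finer than the neighbourhood filter
    of [1]. *)
Definition coloring_system (G : topologicalGroupType) : set_system G :=
  [set V | exists c : G -> nat, forall x y, c x = c y -> V (x^-1 * y)].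

Lemma coloring_system_filter (G : topologicalGroupType) :
  Filter (@coloring_system G).
Proof.
split.
- by exists (fun=> 0%N).
- move=> U V [c cU] [d dV]; exists (fun x => choice.pickle (c x, d x)) => x y.
  by move=> /(pcan_inj choice.pickleK)[/cU ? /dV].
- by move=> U V UV [c cU]; exists c => x y /cU/UV.
Qed.

(** Convergence of a filter in a product is tested on coordinates, and a
    colouring of a factor can be pulled back. *)
Lemma product_narrow (I : Type) (H : I -> topologicalGroupType) :
  (forall i, narrow (H i)) -> narrow (prod_topology H).
Proof.
move=> narH; suff : @coloring_system (prod_topology H) --> (1 : prod_topology H).
  by [].
apply: prodg_cvg; first exact: coloring_system_filter.
move=> i V /narH[c cV]; exists (fun f => c (f i)) => f g; exact: cV.
Qed.

Lemma subgroup_narrow (G H : topologicalGroupType) :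
  topological_subgroup_of G H -> narrow H -> narrow G.
Proof.
move=> [phi [_ phiM openE]] narH V.
have phi1 : phi 1 = 1 by apply: (mulgI (phi 1)); rewrite -phiM !mulg1.
have phiVM x y : phi (x^-1 * y) = (phi x)^-1 * phi y.
  by apply: (mulgI (phi x)); rewrite -phiM mulVKg mulVKg.
rewrite nbhsE => -[B [oB B1] BV].
move: oB; rewrite openE => -[O oO OB].
rewrite -{}OB in B1 BV.
have [|c cO] := narH O.
  by apply: open_nbhs_nbhs; split=> //; rewrite -phi1; exact: B1.
by exists (c \o phi) => x y /cO Oxy; apply: BV; rewrite /= phiVM.
Qed.
End NarrowSubgroup.

(** * Narrow FSIN groups are SIN *)

Theorem corollary2p4 (R : realType) (G : topologicalGroupType)
  (hausG : hausdorff_space G) (fsinG : FSIN R G)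
  (hG : (exists (I : Type) (H : I -> topologicalGroupType),
           (forall i, hausdorff_space (H i)) /\
           (forall i, @second_countable (H i)) /\
           topological_subgroup_of G (prod_topology H)) \/
        separable G \/
        lindelof G \/
        sigma_compact G \/
        countable [set: G]) :
  SIN G.
Proof.
have narG : narrow G.
  case: hG => [[I [H [_ [scH GH]]]]|[|[|[|]]]].
  - apply: subgroup_narrow GH _; apply: product_narrow => i.
    exact: second_countable_narrow.
  - exact: separable_narrow.
  - exact: lindelof_narrow.
  - exact: sigma_compact_narrow.
  - exact: countable_narrow.
have absG := FSIN_absorbing fsinG.
apply: inner_invariant_base_SIN.
have [[W W1 Wtb]|ntb] :=
    pselect (exists2 W, nbhs (1%g : G) W & totally_bounded W).
  exact: inner_invariant_base_totally_bounded Wtb.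
by apply: inner_invariant_base_narrow => // W W1 Wtb; apply: ntb; exists W.
Qed.
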